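(* Let $n\in\{1,2,\dots\}$. Then $$\frac{d}{d\delta}\bigl[\ln MG_{n,\delta}\bigr]=-\ln\bigl(u_n(\delta)\bigr),\qquad \delta\in(n,n+1).$$
   Context: For $n\in\{1,2,\dots\}$ and $\delta\in(n,n+1)$, $$G_{n,\delta}(u)=(-1)^{n+1}\,\frac{e^{-u}-\Bigl(1-\frac{u^1}{1!}+\dots+(-1)^n\frac{u^n}{n!}\Bigr)}{u^{\delta}}\quad(u>0),\qquad G_{n,\delta}(0)=0.$$ $u_n(\delta)$ denotes the unique positive solution $u$ of $$e^{-u}=1-\frac{u^1}{1!}+\dots+(-1)^{n-1}\frac{u^{n-1}}{(n-1)!}+(-1)^n\frac{\delta u^n}{n!\,(u+\delta)},$$ and $MG_{n,\delta}=\max_{u\ge 0}G_{n,\delta}(u)=G_{n,\delta}(u_n(\delta))$. *)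

(* Defs.v *)
(* Concrete classical reals of the standard library, with Coquelicot. *)
From Stdlib Require Import Arith Reals.
From Coquelicot Require Import Coquelicot.
Open Scope R_scope.

Definition taylor_exp_neg (n : nat) (u : R) : R :=
  sum_f_R0 (fun k => (-1) ^ k * (u ^ k / INR (fact k))) n.

(* Only the values at u >= 0 matter; the value 0 at u < 0 is a convention. *)
Definition G (n : nat) (delta u : R) : R :=
  if Rlt_dec 0 u
  then (-1) ^ (n + 1) * ((exp (- u) - taylor_exp_neg n u) / Rpower u delta)
  else 0.

(* Meant for 1 <= n, so that the truncated subtraction n - 1 is harmless. *)
Definition critical_eq (n : nat) (delta u : R) : Prop :=
  exp (- u) =
    taylor_exp_neg (n - 1) u
    + (-1) ^ n * (delta * u ^ n / (INR (fact n) * (u + delta))).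

(* [iota P] is Coquelicot's definite description, "the x such that P x": it
   satisfies P as soon as [exists! x, P x] ([iota_correct]). *)
Definition u_crit (n : nat) (delta : R) : R :=
  iota (fun u : R => 0 < u /\ critical_eq n delta u).

Definition is_max_on_nonneg (f : R -> R) (m : R) : Prop :=
  (exists u, 0 <= u /\ f u = m) /\ (forall u, 0 <= u -> f u <= m).

Definition MG (n : nat) (delta : R) : R :=
  iota (fun m : R => is_max_on_nonneg (G n delta) m).

(* Main.v *)
Require Import Defs.
From Stdlib Require Import Arith Reals Lra Lia.
From Coquelicot Require Import Coquelicot.
Open Scope R_scope.

(** On u > 0 the logarithm of G n d u is [log_G n d u = A u - d * ln u], where A
    is the logarithm of the signed Taylor remainder of exp (- u). So ln (MG n d)
    is a maximum of functions that are affine in d, and the affine function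
    that attains it at d has slope - ln (u_crit n d). Comparing the maximum at
    d' with the value at the maximizer of d, and conversely, gives
      (d' - d) * (- ln (u_crit n d)) <= ln (MG n d') - ln (MG n d)
                                     <= (d' - d) * (- ln (u_crit n d')),
    and continuity of u_crit in d turns this squeeze into the derivative
    ([envelope]). No derivative of u_crit in d is ever taken.

    What remains is to see that u_crit is the maximizer and is continuous. Both
    come from one fact: [slope n d u], which up to a positive factor is the
    u-derivative of [log_G n d], is positive and then negative, with a single
    zero ([slope_crosses_down]). The u-derivative of [slope (n+1) d] is
    [slope n (d-1)], so this follows by induction on n: a function that vanishes
    at 0, has a derivative of this sign pattern and ends up negative has the same
    sign pattern ([crosses_down_primitive]). The single zero is u_crit because
    vanishing of the slope is the critical equation in another form
    ([critical_eq_slope]). It is a maximizer by the signs on its two sides, and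
    it is continuous because strict signs of the slope at u_crit - e and
    u_crit + e persist for nearby d ([u_crit_continuous]). *)

(** * Functions that change sign once, from positive to negative *)

Lemma increment_mean_value (f f' : R -> R) (a b : R) :
  (forall x, a <= x <= b -> is_derive f x (f' x)) -> a < b ->
  exists c, f b - f a = f' c * (b - a) /\ a < c < b.
Proof.
  intros Hd Hab.
  apply (MVT_cor2 f f' a b Hab).
  intros c Hc; apply is_derive_Reals; auto.
Qed.

Definition crosses_down_at (f : R -> R) (b : R) : Prop :=
  0 < b /\ (forall u, 0 < u < b -> 0 < f u) /\ f b = 0 /\
  (forall u, b < u -> f u < 0).

Lemma crosses_down_unique (f : R -> R) (b u : R) :
  crosses_down_at f b -> 0 < u -> f u = 0 -> u = b.
Proof.
  intros (Hb & Hpos & _ & Hneg) Hu Hfu.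
  destruct (Rtotal_order u b) as [H | [H | H]]; auto.
  - specialize (Hpos u); lra.
  - specialize (Hneg u); lra.
Qed.

(** The uniform gap c makes the property pass to primitives: negativity alone
    would not, since a primitive of a negative function may stay positive. *)
Definition eventually_below_zero (f : R -> R) : Prop :=
  exists c M, 0 < c /\ forall u, M < u -> f u <= - c.

Lemma eventually_below_zero_primitive (f f' : R -> R) :
  (forall x, is_derive f x (f' x)) ->
  eventually_below_zero f' -> eventually_below_zero f.
Proof.
  intros Hd (c & M & Hc & HM).
  (* From M on, f loses at least c per unit: the length Rabs (f M) / c brings
     f down from f M to 0, and one more unit down to - c. *)
  exists c, (M + 1 + Rabs (f M) / c); split; auto.
  intros u Hu.
  assert (Hq : 0 <= Rabs (f M) / c).
  { apply Rdiv_le_0_compat; auto; apply Rabs_pos. }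
  assert (HMu : M < u) by lra.
  destruct (increment_mean_value f f' M u (fun x _ => Hd x) HMu)
    as (z & Hz & Hzu).
  specialize (HM z (proj1 Hzu)).
  assert (Habs := Rle_abs (f M)).
  assert (Heq : Rabs (f M) = Rabs (f M) / c * c) by (field; lra).
  assert (f' z * (u - M) <= - c * (u - M)).
  { apply Rmult_le_compat_r; lra. }
  assert (c * (1 + Rabs (f M) / c) <= c * (u - M)).
  { apply Rmult_le_compat_l; lra. }
  lra.
Qed.

(** Such an f rises from 0 up to b and decreases after b, so it can vanish only
    beyond b and at most once; as it ends up negative, it does vanish. *)
Lemma crosses_down_primitive (f f' : R -> R) (b : R) :
  (forall x, is_derive f x (f' x)) -> f 0 = 0 ->
  crosses_down_at f' b -> eventually_below_zero f ->
  exists b', crosses_down_at f b'.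
Proof.
  intros Hd H0 (Hb & Hpos & _ & Hneg) (c & M & Hc & HM).
  set (v := Rmax M 0 + 1).
  assert (HMv : M < v /\ 0 < v)
    by (unfold v; assert (HM1 := Rmax_l M 0);
        assert (HM2 := Rmax_r M 0); lra).
  assert (Hfv : f v < 0) by (specialize (HM v); lra).
  assert (Hup : forall u, 0 < u <= b -> 0 < f u).
  { intros u Hu.
    destruct (increment_mean_value f f' 0 u (fun x _ => Hd x) (proj1 Hu))
      as (z & Hz & Hzu).
    assert (0 < f' z * (u - 0)).
    { apply Rmult_lt_0_compat; [apply Hpos|]; lra. }
    lra. }
  assert (Hdown : forall x y, b <= x -> x < y -> f y < f x).
  { intros x y Hx Hxy.
    destruct (increment_mean_value f f' x y (fun t _ => Hd t) Hxy)
      as (z & Hz & Hzu).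
    assert (0 < (- f' z) * (y - x)).
    { apply Rmult_lt_0_compat; [specialize (Hneg z)|]; lra. }
    lra. }
  assert (Hbv : b < v).
  { destruct (Rlt_le_dec b v) as [H | H]; auto.
    specialize (Hup v); lra. }
  assert (Hfb : 0 < f b) by (apply Hup; lra).
  assert (Hcont : continuity f).
  { intros x; apply derivable_continuous_pt.
    exists (f' x); apply is_derive_Reals, Hd. }
  destruct (IVT_cor f b v Hcont) as (z & Hz & Hfz); [lra | nra |].
  assert (b <> z) by (intros ->; lra).
  exists z; repeat split; auto; [lra | |].
  - intros u Hu. destruct (Rle_lt_dec u b) as [H1 | H1]; [apply Hup; lra |].
    rewrite <- Hfz; apply Hdown; lra.
  - intros u Hu. rewrite <- Hfz; apply Hdown; lra.
Qed.

(** * Signed Taylor remainders of exp (- u) *)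

(** The recursion comes from the fact that consecutive signed remainders add up
    to the monomial by which the two Taylor polynomials differ. The index
    counts the Taylor terms subtracted, so that the remainder at 0 is
    exp (- u) itself and the numerator of [G n] is [exp_rem (S n)]. *)
Fixpoint exp_rem (n : nat) (u : R) : R :=
  match n with
  | O => exp (- u)
  | S m => u ^ m / INR (fact m) - exp_rem m u
  end.

Lemma sign_square (n : nat) : (-1) ^ n * (-1) ^ n = 1.
Proof.
  rewrite <- Rpow_mult_distr. replace (-1 * -1) with 1 by ring. apply pow1.
Qed.

Lemma exp_rem_taylor (n : nat) (u : R) :
  exp_rem (S n) u = (-1) ^ (n + 1) * (exp (- u) - taylor_exp_neg n u).
Proof.
  induction n as [|n IH].
  - unfold taylor_exp_neg; simpl; field.
  - change (exp_rem (S (S n)) u) with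
      (u ^ S n / INR (fact (S n)) - exp_rem (S n) u).
    rewrite IH.
    change (taylor_exp_neg (S n) u) with
      (taylor_exp_neg n u + (-1) ^ S n * (u ^ S n / INR (fact (S n)))).
    replace (S n + 1)%nat with (S (S n)) by lia.
    replace (n + 1)%nat with (S n) by lia.
    assert (Hs : (-1) ^ S n * (-1) ^ S n = 1) by apply sign_square.
    replace ((-1) ^ S (S n)) with (- (-1) ^ S n)
      by (change ((-1) ^ S (S n)) with (-1 * (-1) ^ S n); ring).
    set (s := (-1) ^ S n) in *. set (q := u ^ S n / INR (fact (S n))).
    transitivity (s * s * q - s * (exp (- u) - taylor_exp_neg n u));
      [rewrite Hs; ring | ring].
Qed.

Lemma exp_rem_0 (n : nat) : exp_rem (S n) 0 = 0.
Proof.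
  induction n as [|n IH].
  - simpl; rewrite Ropp_0, exp_0; field.
  - change (exp_rem (S (S n)) 0) with
      (0 ^ S n / INR (fact (S n)) - exp_rem (S n) 0).
    rewrite IH, pow_i by lia. unfold Rdiv; ring.
Qed.

Lemma is_derive_exp_rem (n : nat) (u : R) :
  is_derive (exp_rem (S n)) u (exp_rem n u).
Proof.
  induction n as [|n IH].
  - simpl. auto_derive; auto. ring.
  - apply (is_derive_minus (fun u => u ^ S n / INR (fact (S n)))
             (exp_rem (S n)) u (u ^ n / INR (fact n)) (exp_rem n u));
      [| exact IH].
    auto_derive; auto.
    change (1 * (INR (S n) * u ^ n) * / INR (S n * fact n)
            = u ^ n / INR (fact n)).
    rewrite mult_INR.
    field; split; [apply INR_fact_neq_0 | apply not_0_INR; lia].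
Qed.

Lemma exp_rem_pos (n : nat) (u : R) : 0 < u -> 0 < exp_rem n u.
Proof.
  revert u; induction n as [|n IH]; intros u Hu.
  - apply exp_pos.
  - destruct (increment_mean_value (exp_rem (S n)) (exp_rem n) 0 u
                (fun x _ => is_derive_exp_rem n x) Hu) as (z & Hz & Hzu).
    rewrite exp_rem_0 in Hz.
    assert (0 < exp_rem n z * (u - 0)).
    { apply Rmult_lt_0_compat; [apply IH|]; lra. }
    lra.
Qed.

(** * The sign of the derivative of G *)

(** The u-derivative of exp_rem (S n) u / u^d is slope n d u / u^(d+1). *)
Definition slope (n : nat) (d u : R) : R :=
  u * exp_rem n u - d * exp_rem (S n) u.

(** Differentiating u * exp_rem (S n) u leaves one extra copy of
    exp_rem (S n) u, which lowers d by 1: the condition n < d < n + 1 is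
    therefore inherited, and induction on n is possible. *)
Lemma is_derive_slope (n : nat) (d u : R) :
  is_derive (slope (S n) d) u (slope n (d - 1) u).
Proof.
  unfold slope.
  assert (H1 := is_derive_exp_rem n u).
  assert (H2 := is_derive_exp_rem (S n) u).
  evar_last.
  - apply (is_derive_minus (fun u => u * exp_rem (S n) u)
             (fun u => d * exp_rem (S (S n)) u)).
    + apply (is_derive_mult (fun u => u) (exp_rem (S n)));
        [apply is_derive_id | exact H1 | intros; apply Rmult_comm].
    + apply (is_derive_scal (exp_rem (S (S n)))); exact H2.
  - unfold minus, plus, opp, mult, one; simpl; ring.
Qed.

Lemma slope_0 (n : nat) (d : R) : slope n d 0 = 0.
Proof. unfold slope; rewrite exp_rem_0; ring. Qed.

(** The slope is (u + d) * exp (- u) - d here, with limit - d at infinity. *)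
Lemma slope_0_eventually (d : R) :
  0 < d < 1 -> eventually_below_zero (slope 0 d).
Proof.
  intros Hd.
  (* Beyond 16 / d both parts of (u + d) * exp (- u) are below d / 4:
     u * exp (- u) is at most 4 / u, and d * exp (- u) is smaller, as d < u. *)
  exists (d / 2), (16 / d); split; [lra |].
  intros u Hu.
  assert (H16 : 16 < u * d).
  { apply Rmult_lt_compat_r with (r := d) in Hu; [| lra].
    unfold Rdiv in Hu; rewrite Rmult_assoc, Rinv_l in Hu; lra. }
  assert (Hu1 : 1 < u) by nra.
  (* Square 1 + u / 2 <= exp (u / 2): a quadratic bound is what makes
     u * exp (- u) small. *)
  assert (Hexp : u * u / 4 <= exp u).
  { replace u with (u / 2 + u / 2) at 3 by field.
    rewrite exp_plus.
    assert (H := exp_ineq1_le (u / 2)). nra. }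
  assert (Hinv : exp u * exp (- u) = 1).
  { rewrite <- exp_plus, Rplus_opp_r; apply exp_0. }
  assert (He := exp_pos (- u)).
  assert (H : u * u * exp (- u) <= 4) by nra.
  assert (Hx : u * (u * exp (- u)) <= 4) by lra.
  assert (Hd4 : u * exp (- u) <= d / 4) by nra.
  unfold slope; simpl. nra.
Qed.

(** In the base case the derivative of the slope is exp (- u) * (1 - d - u),
    which changes sign at 1 - d. This point is positive because d < n + 1,
    while n < d makes the slope end up negative. *)
Lemma slope_crosses_down (n : nat) (d : R) :
  INR n < d < INR n + 1 ->
  (exists b, crosses_down_at (slope n d) b) /\ eventually_below_zero (slope n d).
Proof.
  revert d; induction n as [|n IH]; intros d Hd.
  - simpl in Hd.
    assert (Hev : eventually_below_zero (slope 0 d))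
      by (apply slope_0_eventually; lra).
    split; auto.
    apply (crosses_down_primitive (slope 0 d)
             (fun u => exp (- u) * (1 - d - u)) (1 - d)); auto.
    + intros u; unfold slope; simpl. auto_derive; auto. field.
    + apply slope_0.
    + repeat split; try lra.
      * intros u Hu; apply Rmult_lt_0_compat; [apply exp_pos | lra].
      * intros u Hu. assert (He := exp_pos (- u)). nra.
  - rewrite S_INR in Hd.
    destruct (IH (d - 1)) as ((b & Hb) & Hev'); [lra |].
    assert (Hev := eventually_below_zero_primitive _ _
                     (is_derive_slope n d) Hev').
    split; auto.
    apply (crosses_down_primitive _ _ b (is_derive_slope n d)); auto.
    apply slope_0.
Qed.

(** Eliminating exp_rem (S n) by exp_rem n + exp_rem (S n) = u^n / n! writes the
    slope as (u + d) * (exp_rem n u - d * u^n / (n! * (u + d))), and the second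
    factor is the defect of the critical equation up to sign. *)
Lemma critical_eq_slope (n : nat) (d u : R) :
  (1 <= n)%nat -> 0 < d -> 0 < u ->
  critical_eq n d u <-> slope n d u = 0.
Proof.
  intros Hn Hd Hu. destruct n as [|m]; [lia |].
  unfold critical_eq, slope.
  replace (S m - 1)%nat with m by lia.
  assert (Ht := exp_rem_taylor m u).
  replace (m + 1)%nat with (S m) in Ht by lia.
  change (exp_rem (S (S m)) u) with
    (u ^ S m / INR (fact (S m)) - exp_rem (S m) u).
  set (r := exp_rem (S m) u) in *.
  assert (Hs : (-1) ^ S m * (-1) ^ S m = 1) by apply sign_square.
  set (s := (-1) ^ S m) in *. set (k := INR (fact (S m))).
  assert (Hk : k <> 0) by apply INR_fact_neq_0.
  assert (Hexp : exp (- u) = taylor_exp_neg m u + s * r).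
  { rewrite Ht, <- Rmult_assoc, Hs; ring. }
  rewrite Hexp.
  assert (Hq : u * r - d * (u ^ S m / k - r)
             = (u + d) * (r - d * u ^ S m / (k * (u + d)))).
  { field; split; [lra | auto]. }
  rewrite Hq. split; intros H.
  - replace r with (s * s * r) by (rewrite Hs; ring).
    rewrite Rmult_assoc. replace (s * r) with
      (s * (d * u ^ S m / (k * (u + d)))) by lra.
    rewrite <- Rmult_assoc, Hs; ring.
  - apply Rmult_integral in H; destruct H as [H | H]; [lra |].
    replace r with (d * u ^ S m / (k * (u + d))) by lra. reflexivity.
Qed.

Lemma u_crit_crosses_down (n : nat) (d : R) :
  (1 <= n)%nat -> INR n < d < INR n + 1 ->
  crosses_down_at (slope n d) (u_crit n d).
Proof.
  intros Hn Hd.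
  assert (H0 := pos_INR n).
  destruct (slope_crosses_down n d Hd) as ((b & Hb) & _).
  assert (Hiff : forall u, 0 < u -> critical_eq n d u <-> slope n d u = 0)
    by (intros u Hu; apply critical_eq_slope; auto; lra).
  replace (u_crit n d) with b; auto.
  symmetry; unfold u_crit; apply (iota_unique (V := R_CompleteNormedModule)).
  - intros u (Hu & Hc). apply (crosses_down_unique _ b u Hb Hu).
    apply Hiff; auto.
  - destruct Hb as (Hb & _ & Hz & _). split; auto. apply Hiff; auto.
Qed.

(** * The maximum of G *)

(** Taking logarithms makes the dependence on d affine, so that two values of d
    can be compared exactly at the same u. *)
Definition log_G (n : nat) (d u : R) : R := ln (exp_rem (S n) u) - d * ln u.

Lemma is_derive_log_G (n : nat) (d u : R) :
  0 < u -> is_derive (log_G n d) u (slope n d u / (u * exp_rem (S n) u)).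
Proof.
  intros Hu. assert (Hr := exp_rem_pos (S n) u Hu).
  unfold log_G, slope.
  evar_last.
  - apply (is_derive_minus (fun u => ln (exp_rem (S n) u))
             (fun u => d * ln u)).
    + apply (is_derive_comp ln (exp_rem (S n)));
        [apply is_derive_ln; exact Hr | apply is_derive_exp_rem].
    + apply (is_derive_scal ln); apply is_derive_ln; exact Hu.
  - change (exp_rem n u * / exp_rem (S n) u + - (d * / u)
            = (u * exp_rem n u - d * exp_rem (S n) u) / (u * exp_rem (S n) u)).
    field; lra.
Qed.

Lemma G_exp_log_G (n : nat) (d u : R) : 0 < u -> G n d u = exp (log_G n d u).
Proof.
  intros Hu. unfold G. destruct (Rlt_dec 0 u) as [_ | H]; [| lra].
  unfold log_G, Rminus. rewrite exp_plus, exp_ln by (now apply exp_rem_pos).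
  rewrite (exp_Ropp (d * ln u)), exp_rem_taylor. unfold Rpower, Rdiv, Rminus. ring.
Qed.

Lemma crosses_down_maximum (f f' : R -> R) (b u : R) :
  (forall x, 0 < x -> is_derive f x (f' x)) -> crosses_down_at f' b ->
  0 < u -> f u <= f b.
Proof.
  intros Hd (Hb & Hpos & _ & Hneg) Hu.
  destruct (Rtotal_order u b) as [H | [-> | H]]; [| lra |].
  - destruct (increment_mean_value f f' u b) as (z & Hz & Hzu); auto.
    { intros x Hx; apply Hd; lra. }
    assert (0 < f' z * (b - u)).
    { apply Rmult_lt_0_compat; [apply Hpos|]; lra. }
    lra.
  - destruct (increment_mean_value f f' b u) as (z & Hz & Hzu); auto.
    { intros x Hx; apply Hd; lra. }
    assert (0 < (- f' z) * (u - b)).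
    { apply Rmult_lt_0_compat; [specialize (Hneg z)|]; lra. }
    lra.
Qed.

Lemma log_G_le_u_crit (n : nat) (d u : R) :
  (1 <= n)%nat -> INR n < d < INR n + 1 -> 0 < u ->
  log_G n d u <= log_G n d (u_crit n d).
Proof.
  intros Hn Hd Hu.
  apply (crosses_down_maximum (log_G n d)
           (fun u => slope n d u / (u * exp_rem (S n) u))); auto.
  { intros x Hx; now apply is_derive_log_G. }
  destruct (u_crit_crosses_down n d Hn Hd) as (Hb & Hpos & Hz & Hneg).
  assert (Hden : forall x, 0 < x -> 0 < / (x * exp_rem (S n) x)).
  { intros x Hx. apply Rinv_0_lt_compat, Rmult_lt_0_compat; auto.
    now apply exp_rem_pos. }
  repeat split; auto.
  - intros x Hx. apply Rmult_lt_0_compat; [auto | apply Hden; lra].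
  - rewrite Hz. unfold Rdiv; ring.
  - intros x Hx. assert (H1 := Hden x ltac:(lra)). assert (H2 := Hneg x Hx).
    unfold Rdiv. nra.
Qed.

Lemma ln_MG (n : nat) (d : R) :
  (1 <= n)%nat -> INR n < d < INR n + 1 ->
  ln (MG n d) = log_G n d (u_crit n d).
Proof.
  intros Hn Hd.
  destruct (u_crit_crosses_down n d Hn Hd) as (Hb & _).
  assert (Hmax : is_max_on_nonneg (G n d) (G n d (u_crit n d))).
  { split; [exists (u_crit n d); split; [lra | auto] |].
    intros u [Hu | <-]; rewrite (G_exp_log_G n d (u_crit n d) Hb).
    - rewrite G_exp_log_G by auto.
      destruct (log_G_le_u_crit n d u Hn Hd Hu) as [H | ->]; [| lra].
      left; now apply exp_increasing.
    - unfold G. destruct (Rlt_dec 0 0) as [H | _]; [lra |].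
      left; apply exp_pos. }
  replace (MG n d) with (G n d (u_crit n d)).
  { rewrite G_exp_log_G, ln_exp; auto. }
  symmetry; unfold MG; apply (iota_unique (V := R_CompleteNormedModule)); auto.
  intros m ((u & Hu & <-) & Hle).
  apply Rle_antisym; [now apply Hmax | apply Hle; lra].
Qed.

(** * Dependence on delta *)

Lemma locally_open_interval (a b x : R) :
  a < x < b -> locally x (fun y => a < y < b).
Proof.
  intros Hx. apply filter_and; [apply (open_gt a) | apply (open_lt b)]; lra.
Qed.

(** For fixed u the slope is affine in d. Hence for d' near d it is still positive
    at u_crit n d - e and negative at u_crit n d + e, and its zero stays in
    between. *)
Lemma u_crit_continuous (n : nat) (d : R) :
  (1 <= n)%nat -> INR n < d < INR n + 1 -> continuous (u_crit n) d.
Proof.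
  intros Hn Hd.
  destruct (u_crit_crosses_down n d Hn Hd) as (Hb & Hpos & _ & Hneg).
  set (b := u_crit n d) in *.
  apply filterlim_locally; intros eps.
  assert (He := cond_pos eps).
  (* Capping e at b / 2 keeps b - e positive, where the sign of the slope is
     known. *)
  set (e := Rmin eps (b / 2)).
  assert (He1 : e <= eps) by apply Rmin_l.
  assert (He2 : e <= b / 2) by apply Rmin_r.
  assert (He0 : 0 < e) by (apply Rmin_glb_lt; lra).
  assert (Hcont : forall u, continuous (fun d' => slope n d' u) d).
  { intros u. apply (ex_derive_continuous (fun d' => slope n d' u)).
    unfold slope; auto_derive; auto. }
  assert (Hl : locally d (fun d' => 0 < slope n d' (b - e))).
  { apply (Hcont (b - e) (fun y => 0 < y)). apply (open_gt 0). apply Hpos; lra. }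
  assert (Hr : locally d (fun d' => slope n d' (b + e) < 0)).
  { apply (Hcont (b + e) (fun y => y < 0)). apply (open_lt 0). apply Hneg; lra. }
  assert (Hi : locally d (fun d' => INR n < d' < INR n + 1))
    by now apply locally_open_interval.
  generalize (filter_and _ _ Hi (filter_and _ _ Hl Hr)).
  apply filter_imp; intros d' (Hd' & Hl' & Hr').
  destruct (u_crit_crosses_down n d' Hn Hd') as (Hb' & Hpos' & Hz' & Hneg').
  set (b' := u_crit n d') in *.
  assert (b - e <= b').
  { apply Rnot_lt_le; intros Hlt; specialize (Hneg' _ Hlt); lra. }
  assert (b' <= b + e).
  { apply Rnot_lt_le; intros Hlt; specialize (Hpos' (b + e)); lra. }
  assert (b' <> b - e) by (intros E; rewrite E in Hz'; lra).
  assert (b' <> b + e) by (intros E; rewrite E in Hz'; lra).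
  change (Rabs (b' - b) < eps). apply Rabs_def1; lra.
Qed.

(** The two hypotheses confine M d' - M d - (d' - d) * g d between 0 and
    (d' - d) * (g d' - g d), which is o(d' - d) because g is continuous at d. *)
Lemma envelope (M g : R -> R) (d : R) :
  locally d (fun d' => M d + (d' - d) * g d <= M d') ->
  locally d (fun d' => M d' + (d - d') * g d' <= M d) ->
  continuous g d -> is_derive M d (g d).
Proof.
  intros Hlow Hup Hg.
  split; [apply is_linear_scal_l |].
  intros x Hx. rewrite <- (is_filter_lim_locally_unique _ _ Hx).
  intros eps.
  assert (Hc := proj1 (filterlim_locally g (g d)) Hg eps).
  generalize (filter_and _ _ Hc (filter_and _ _ Hlow Hup)).
  apply filter_imp; intros d' (Hball & Hl & Hu).
  change (Rabs (g d' - g d) < eps) in Hball.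
  change (Rabs (M d' - M d - (d' - d) * g d) <= eps * Rabs (d' - d)).
  apply Rle_trans with (Rabs ((g d' - g d) * (d' - d))).
  - rewrite (Rabs_pos_eq (M d' - M d - _)) by lra.
    apply Rle_trans with ((g d' - g d) * (d' - d)); [lra | apply Rle_abs].
  - rewrite Rabs_mult. apply Rmult_le_compat_r; [apply Rabs_pos | lra].
Qed.

Theorem proposition23 (n : nat) (hn : (1 <= n)%nat) (delta : R)
    (hdelta : INR n < delta < INR n + 1) :
  is_derive (fun d : R => ln (MG n d)) delta (- ln (u_crit n delta)).
Proof.
  assert (Hi : locally delta (fun d => INR n < d < INR n + 1))
    by now apply locally_open_interval.
  assert (Hpos : forall d, INR n < d < INR n + 1 -> 0 < u_crit n d)
    by (intros d Hd; apply (u_crit_crosses_down n d hn Hd)).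
  apply (envelope (fun d => ln (MG n d)) (fun d => - ln (u_crit n d))).
  - revert Hi; apply filter_imp; intros d Hd.
    rewrite !ln_MG by auto.
    assert (H := log_G_le_u_crit n d (u_crit n delta) hn Hd (Hpos _ hdelta)).
    unfold log_G in *; lra.
  - revert Hi; apply filter_imp; intros d Hd.
    rewrite !ln_MG by auto.
    assert (H := log_G_le_u_crit n delta (u_crit n d) hn hdelta (Hpos _ Hd)).
    unfold log_G in *; lra.
  - apply (continuous_opp (fun d => ln (u_crit n d))).
    apply (continuous_comp (u_crit n) ln); [now apply u_crit_continuous |].
    apply (ex_derive_continuous ln). eexists; apply is_derive_ln.
    now apply Hpos.
Qed.
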